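(* Let $G$ be a finite simple undirected graph with vertex set $V(G)$ and edge set $E(G)$, and let $\Bbbk$ be a field with $\operatorname{char}(\Bbbk)\neq 2$. Then the parity binomial edge ideal \[ \mathcal{I}_G=\langle x_ix_j-y_iy_j : \{i,j\}\in E(G)\rangle\subseteq \Bbbk[x_i,y_i : i\in V(G)] \] is a radical ideal.
   Context: Graphs are finite and simple (no loops, no multiple edges). The polynomial ring $\Bbbk[x_i,y_i:i\in V(G)]$ has $2|V(G)|$ indeterminates. The ideal $\mathcal{I}_G$ displayed in the claim is called the parity binomial edge ideal of $G$. *)

(* Defs.v *)
From HB Require Import structures.
From mathcomp Require Import all_boot all_order all_algebra.
From mathcomp Require Import mpoly.

Set Implicit Arguments.
Unset Strict Implicit.
Unset Printing Implicit Defensive.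

Import GRing.Theory.
Local Open Scope ring_scope.

(* [idealr] of mathcomp's ring_quotient requires boolean membership and
   excludes the unit ideal, hence the following Prop-valued notions. *)
Definition is_ideal (R : comNzRingType) (I : R -> Prop) : Prop :=
  [/\ I 0, forall p q, I p -> I q -> I (p + q) & forall a p, I p -> I (a * p)].

Definition generated_ideal (R : comNzRingType) (S : R -> Prop) (p : R) : Prop :=
  exists s : seq (R * R),
    (forall c, c \in s -> S c.2) /\ p = \sum_(c <- s) c.1 * c.2.

Definition radical (R : comNzRingType) (I : R -> Prop) (p : R) : Prop :=
  exists n : nat, (0 < n)%N /\ I (p ^+ n).

Definition radical_ideal (R : comNzRingType) (I : R -> Prop) : Prop :=
  is_ideal I /\ (forall p, radical I p <-> I p).

(* The 2 #|V| indeterminates: the first block holds the x_i, the second the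
   y_i, where the vertices are numbered by [enum_rank]. *)
Definition xvar (k : fieldType) (V : finType) (i : V)
  : {mpoly k[#|V| + #|V|]} := 'X_(lshift #|V| (enum_rank i)).

Definition yvar (k : fieldType) (V : finType) (i : V)
  : {mpoly k[#|V| + #|V|]} := 'X_(rshift #|V| (enum_rank i)).

Definition parity_binomial_generator (k : fieldType) (V : finType)
    (adj : rel V) (g : {mpoly k[#|V| + #|V|]}) : Prop :=
  exists i j : V, adj i j /\ g = xvar k i * xvar k j - yvar k i * yvar k j.

Definition parity_binomial_edge_ideal (k : fieldType) (V : finType)
    (adj : rel V) : {mpoly k[#|V| + #|V|]} -> Prop :=
  generated_ideal (@parity_binomial_generator k V adj).
Arguments parity_binomial_edge_ideal k {V} adj _.

(* Main.v *)
Require Import Defs.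
From mathcomp Require Import all_boot all_order all_algebra.
From mathcomp Require Import mpoly.
From mathcomp Require Import zify ring.

(** Why the ideal I of G is radical.  It suffices to find ring morphisms into
    integral domains that all vanish on I and whose kernels meet in I.  Write
    z(i,false) = x_i and z(i,true) = y_i, so that I is generated by the
    z(i,b) z(j,b) - z(i,~b) z(j,~b).  For a set W of vertices, consider the
    bipartite double cover of G[W], whose vertices are the pairs (i,b) and
    whose edges join (i,b) to (j,~b) when ij is an edge of G[W]; let K(i,b) be
    the component of (i,b).  For signs s constant on the components of G[W],
    the morphism [phi W s] sends every z(i,_) with i outside W to 0 and

      x_i to T_i X_{K(i,false)},     y_i to s_i T_i X_{K(i,true)}

    for i in W.  An edge ij satisfies K(i,b) = K(j,~b) and s_i s_j = 1, so this
    kills the generators ([phi_kills]).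

    That nothing outside I is killed by all of these morphisms rests on two
    facts.

    - Monomials with the same images are congruent modulo I
      ([cong_of_phi_eq]).  A walk in the double cover from u to v lets one
      trade z_u z_{flip v} for z_{flip u} z_v inside any monomial with support
      W ([connect_exchange]).  If m and m' are distinct with the same image,
      then m has too many factors z_u for some u; as the X_K-degrees agree, it
      has too few factors z_v for some v in the component of u, and the trade
      brings m closer to m'.  The trade can only overshoot if v = flip u and
      m, m' differ by a single factor over the component of G[W] involved; the
      signs, which see the parity of the y-degree over that component, exclude
      this ([parity_gap]).

    - If p is killed, then the coefficients of p over the monomials with the
      same image as a given m0 sum to 0 ([sum_same_image]).  The coefficient of
      one monomial in [phi W s] p is a signed sum of coefficients of p;
      averaging over s isolates the sign character of m0, by orthogonality of
      characters.  This divides by a power of 2.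

    So the part of p carried by such a class of monomials is a combination of
    differences lying in I, and removing it shortens p ([joint_kernel]). *)

Set Implicit Arguments.
Unset Strict Implicit.
Unset Printing Implicit Defensive.

Import GRing.Theory.
Local Open Scope ring_scope.

(** * Ideals, radicals and congruences *)

Section GeneratedIdeals.
Variables (R : comNzRingType) (S : R -> Prop).

Lemma generated_ideal_is_ideal : is_ideal (generated_ideal S).
Proof.
split.
- by exists [::]; split=> //; rewrite big_nil.
- move=> p q [s [sS ->]] [t [tS ->]]; exists (s ++ t); split; last by rewrite big_cat.
  by move=> c; rewrite mem_cat => /orP[/sS|/tS].
- move=> a p [s [sS ->]]; exists [seq (a * c.1, c.2) | c <- s]; split.
    by move=> c /mapP[d /sS dS ->].
  by rewrite big_map mulr_sumr; apply: eq_bigr => c _; rewrite mulrA.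
Qed.

Lemma mem_generated_ideal p : S p -> generated_ideal S p.
Proof.
move=> Sp; exists [:: (1, p)]; split; last by rewrite big_seq1 mul1r.
by move=> c; rewrite inE => /eqP->.
Qed.

Lemma rmorph_generated_ideal (R' : comNzRingType) (f : {rmorphism R -> R'}) :
  (forall p, S p -> f p = 0) -> forall p, generated_ideal S p -> f p = 0.
Proof.
move=> fS p [s [sS ->]]; rewrite rmorph_sum big_seq big1 // => c /sS/fS f0.
by rewrite rmorphM f0 mulr0.
Qed.

End GeneratedIdeals.

Section Ideals.
Variables (R : comNzRingType) (I : R -> Prop).
Hypothesis idI : is_ideal I.

Lemma ideal_opp p : I p -> I (- p).
Proof. by case: idI => _ _ IM /(IM (-1)); rewrite mulN1r. Qed.

Lemma ideal_sum (T : eqType) (r : seq T) (P : pred T) (F : T -> R) :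
  (forall i, i \in r -> P i -> I (F i)) -> I (\sum_(i <- r | P i) F i).
Proof.
case: idI => I0 ID _ IF; rewrite big_seq_cond.
by elim/big_rec: _ => // i p /andP[ri Pi]; apply: ID; apply: IF.
Qed.

Lemma radical_ideal_of_domain_maps (T : Type) (D : idomainType)
    (phi : T -> {rmorphism R -> D}) :
    (forall t p, I p -> phi t p = 0) ->
    (forall p, (forall t, phi t p = 0) -> I p) ->
  radical_ideal I.
Proof.
move=> killI kerI; split=> // p; split=> [[n [n_gt0 Ipn]]|Ip]; last first.
  by exists 1%N; rewrite expr1.
apply: kerI => t; apply/eqP; move/(killI t)/eqP: Ipn.
by rewrite rmorphXn expf_eq0 n_gt0.
Qed.

Definition cong p q := I (p - q).

Lemma cong_refl p : cong p p.
Proof. by rewrite /cong subrr; case: idI. Qed.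

Lemma cong_sym p q : cong p q -> cong q p.
Proof. by move=> /ideal_opp; rewrite opprB. Qed.

Lemma cong_trans q p r : cong p q -> cong q r -> cong p r.
Proof. by case: idI => _ ID _ pq qr; have := ID _ _ pq qr; rewrite addrA subrK. Qed.

Lemma cong_mull a p q : cong p q -> cong (a * p) (a * q).
Proof. by case: idI => _ _ IM /(IM a); rewrite mulrBr. Qed.

End Ideals.

(** * Variables indexed by vertex and side *)

Section ParityIdeal.
Variables (k : fieldType) (V : finType) (adj : rel V).
Hypothesis adj_sym : ssrbool.symmetric adj.
Hypothesis adj_irr : irreflexive adj.
Hypothesis two_neq0 : 2%:R != 0 :> k.

Notation n := #|V|.
Notation state := (V * bool)%type.
Notation I := (parity_binomial_edge_ideal k adj).
Notation "p ~~~ q" := (cong I p q) (at level 70).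

(** The pairs (i, false) and (i, true) stand for x_i and y_i; the exchange of
    the two sides is then the deck transformation of the double cover. *)
Definition idx (u : state) : 'I_(n + n) :=
  if u.2 then rshift n (enum_rank u.1) else lshift n (enum_rank u.1).

Definition unidx (t : 'I_(n + n)) : state :=
  match split t with
  | inl a => (enum_val a, false)
  | inr a => (enum_val a, true)
  end.

Lemma idxK : cancel idx unidx.
Proof.
case=> i [] /=; rewrite /idx /unidx /=.
  by rewrite -[rshift _ _]/(unsplit (inr _)) unsplitK enum_rankK.
by rewrite -[lshift _ _]/(unsplit (inl _)) unsplitK enum_rankK.
Qed.

Lemma unidxK : cancel unidx idx.
Proof.
by move=> t; rewrite /idx /unidx; case: split_ordP => j -> /=; rewrite enum_valK.
Qed.

Lemma eq_idx u v : (idx u == idx v) = (u == v).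
Proof. by rewrite (can_eq idxK). Qed.

Definition flip (u : state) : state := (u.1, ~~ u.2).

Lemma flipK : involutive flip.
Proof. by case=> i b; rewrite /flip /= negbK. Qed.

Lemma flip_neq u : (flip u == u) = false.
Proof. by case: u => i []; apply/eqP => -[]. Qed.

Lemma same_vertex (u v : state) : v.1 = u.1 -> v = u \/ v = flip u.
Proof. by case: u v => i b [j c] /= ->; case: b c => [] []; [left|right|right|left]. Qed.

Definition var (u : state) : {mpoly k[n + n]} := 'X_(idx u).

Lemma idealI : is_ideal I. Proof. exact: generated_ideal_is_ideal. Qed.

Hint Resolve idealI : core.

(** * Exchanges along walks of the double cover *)

Section Support.
Variable W : {set V}.

Definition cover_edge : rel state := fun u v =>
  [&& adj u.1 v.1, u.1 \in W, v.1 \in W & v.2 == ~~ u.2].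

Definition support_edge : rel V := fun i j => [&& adj i j, i \in W & j \in W].

Lemma cover_edge_sym : ssrbool.symmetric cover_edge.
Proof.
move=> [i b] [j c]; rewrite /cover_edge /= adj_sym.
by case: (adj j i) (i \in W) (j \in W) b c => [] [] [] [] [].
Qed.

Lemma support_edge_sym : ssrbool.symmetric support_edge.
Proof. by move=> i j; rewrite /support_edge adj_sym [(i \in W) && _]andbC. Qed.

Lemma cong_edge u w p :
  cover_edge u w -> (var u * var (flip w) * p) ~~~ (var (flip u) * var w * p).
Proof.
case: u w => i b [j c] /and4P[/= ij _ _ /eqP->].
rewrite ![_ * p]mulrC; apply: cong_mull => //; rewrite /flip /= negbK.
have g : xvar k i * xvar k j ~~~ (yvar k i * yvar k j).
  by apply: mem_generated_ideal; exists i, j.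
by case: b => //=; apply: cong_sym.
Qed.

(** The trade of z_u z_{flip v} for z_{flip u} z_v.  The cofactor r is only
    asked to meet the vertices of W other than those of u and v, so that the
    whole monomial, and not its part away from a walk, has to be supported on
    W: a walk may then revisit a vertex carrying a single factor. *)
Definition exchange (u v : state) : Prop :=
  forall r : 'X_{1..n + n},
    (forall w, w \in W -> w != u.1 -> w != v.1 -> exists b, (0 < r (idx (w, b)))%N) ->
  (var u * var (flip v) * 'X_[r]) ~~~ (var (flip u) * var v * 'X_[r]).

Lemma exchange_sym u v : exchange u v -> exchange v u.
Proof.
move=> uv r rW; rewrite [var v * _]mulrC [var (flip v) * _]mulrC.
by apply: cong_sym => //; apply: uv => w wW wu wv; apply: rW.
Qed.

(** A factor z_(w, b) of the cofactor serves as a catalyst.  If b is the side of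
    [flip w], the edge is used first and turns it into the factor z_w that the
    exchange between w and v consumes; if b is the side of w, the exchange comes
    first.  Either way the catalyst is restored. *)
Lemma exchange_step u w v :
  cover_edge u w -> w.1 != v.1 -> exchange w v -> exchange u v.
Proof.
move=> uw wv ex r rW.
have [uw_adj uW wW /eqP w2] := and4P uw.
have wu : w.1 != u.1 by apply: contraTneq uw_adj => ->; rewrite adj_irr.
have [b rb] := rW _ wW wu wv.
have [r' rE] : exists r', r = (r' + U_(idx (w.1, b)))%MM.
  exists (r - U_(idx (w.1, b)))%MM; rewrite submK //; apply/mnm_lepP => t.
  by rewrite mnm1E; case: eqP => // <-.
have r'W x : x \in W -> x != w.1 -> x != u.1 -> x != v.1 ->
    exists c, (0 < r' (idx (x, c)))%N.
  move=> xW xw xu xv; have [c] := rW x xW xu xv; rewrite rE mnmDE mnm1E eq_idx.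
  have -> : ((w.1, b) == (x, c)) = false by apply/eqP => -[/eqP]; rewrite eq_sym (negPf xw).
  by rewrite addn0; exists c.
have exr c : (var w * var (flip v) * (var (u.1, c) * 'X_[r'])) ~~~
    (var (flip w) * var v * (var (u.1, c) * 'X_[r'])).
  have -> : var (u.1, c) * 'X_[r'] = 'X_[U_(idx (u.1, c)) + r'] by rewrite mpolyXD.
  apply: ex => x xW xw xv.
  have [->|xu] := eqVneq x u.1.
    by exists c; rewrite mnmDE mnm1E eqxx.
  by have [d d0] := r'W x xW xw xu xv; exists d; rewrite mnmDE addn_gt0 d0 orbT.
rewrite rE mpolyXD -/(var _).
have [bw|bw] : (w.1, b) = w \/ (w.1, b) = flip w by apply: same_vertex.
- rewrite bw.
  apply: (cong_trans idealI (q := var (flip w) * var v * (var u * 'X_[r']))).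
    have := exr u.2; rewrite -surjective_pairing.
    by congr (cong _ _ _); ring.
  have := cong_edge (var v * 'X_[r']) uw.
  by congr (cong _ _ _); ring.
- rewrite bw.
  apply: (cong_trans idealI (q := var (flip u) * var w * (var (flip v) * 'X_[r']))).
    have := cong_edge (var (flip v) * 'X_[r']) uw.
    by congr (cong _ _ _); ring.
  have := exr (~~ u.2); rewrite -/(flip u).
  by congr (cong _ _ _); ring.
Qed.

Fixpoint walk (l : nat) (u v : state) : bool :=
  if l is l'.+1 then [exists w, cover_edge u w && walk l' w v] else u == v.

Lemma walk_rcons l u w v : walk l u w -> cover_edge w v -> walk l.+1 u v.
Proof.
elim: l u => [|l IHl] u.
  by move=> /eqP<- uv; apply/existsP; exists v; rewrite uv /=.
case/existsP=> x /andP[ux xw] wv.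
by apply/existsP; exists x; rewrite ux /=; apply: IHl wv.
Qed.

Lemma walk_sym l u v : walk l u v -> walk l v u.
Proof.
elim: l u => [|l IHl] u; first by rewrite /= eq_sym.
case/existsP=> w /andP[uw /IHl vw]; apply: walk_rcons vw _.
by rewrite cover_edge_sym.
Qed.

Lemma connect_walk u v : connect cover_edge u v -> exists l, walk l u v.
Proof.
case/connectP=> p; elim: p u => [|w p IHp] u /=; first by move=> _ ->; exists 0%N => /=.
case/andP=> uw wp /(IHp _ wp)[l wv].
by exists l.+1; apply/existsP; exists w; rewrite uw.
Qed.

Lemma exchange_edge u v : cover_edge u v -> exchange u v.
Proof. by move=> uv r _; apply: cong_edge. Qed.

(** The catalyst of [exchange_step] is missing when the second vertex of the walk
    lies over the last one.  Then the walk is read backwards, and if the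
    catalyst is missing there as well, the walk goes u, flip v, ..., flip u, v:
    dropping both ends leaves a shorter walk that gives the same exchange. *)
Lemma walk_exchange l u v : walk l u v -> exchange u v.
Proof.
elim/ltn_ind: l u v => -[|l] IHl u v.
  by move=> /eqP-> r _; rewrite [var v * _]mulrC; apply: (cong_refl idealI).
case/existsP=> w /andP[uw wv].
have [wv1|wv1] := eqVneq w.1 v.1; last first.
  by apply: exchange_step uw wv1 (IHl l _ _ _ wv).
have [wE|wE] : w = v \/ w = flip v := same_vertex wv1.
  by rewrite -wE; apply: exchange_edge.
case: l IHl wv => [_ /eqP wv|l IHl wv].
  by have := flip_neq v; rewrite -wE wv eqxx.
have /existsP[x /andP[vx xw]] := walk_sym (l := l.+1) wv.
have [xu|xu] := eqVneq x.1 u.1; last first.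
  apply: exchange_sym; apply: exchange_step vx xu (IHl l.+1 _ _ _ _) => //.
  by apply: walk_rcons xw _; rewrite cover_edge_sym.
have xE : x = flip u.
  case/and4P: uw vx wE => _ _ _ /eqP w2 /and4P[_ _ _ /eqP x2] wE.
  by rewrite [x]surjective_pairing xu x2; move: w2; rewrite wE /= => /negb_inj ->.
have := IHl l _ (flip u) (flip v); rewrite -xE -wE => /(_ _ xw) ex r rW.
have := ex _ r; rewrite xE wE !flipK => {}ex.
by apply: cong_sym => //; apply: ex => // y; rewrite /=; apply: rW.
Qed.

Lemma connect_exchange u v : connect cover_edge u v -> exchange u v.
Proof. by case/connect_walk=> l; apply: walk_exchange. Qed.

(** * The morphisms to domains *)

Notation target := {mpoly k[#|{: V + state}|]}.

(** Composing s with the choice of a root makes the signs constant on the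
    components of G[W], while s ranges over all functions: their number is the
    power of 2 needed for the orthogonality argument. *)
Definition weight (s : {ffun V -> bool}) (u : state) : k :=
  (u.1 \in W)%:R * (-1) ^+ (u.2 && s (fingraph.root support_edge u.1)).

(** The exponent of T_i X_{K(u)}, for u lying over i; the component K(u) is
    represented by its root. *)
Definition expo (u : state) : 'X_{1..#|{: V + state}|} :=
  (U_(enum_rank (inl u.1 : V + state))
   + U_(enum_rank (inr (fingraph.root cover_edge u) : V + state)))%MM.

Definition chi (s : {ffun V -> bool}) (m : 'X_{1..n + n}) : k :=
  \prod_u weight s u ^+ m (idx u).

Definition invariant (m : 'X_{1..n + n}) : 'X_{1..#|{: V + state}|} :=
  (\sum_u expo u *+ m (idx u))%MM.

Definition phi (s : {ffun V -> bool}) : {rmorphism {mpoly k[n + n]} -> target} :=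
  comp_mpoly [tuple weight s (unidx t) *: 'X_[expo (unidx t)] | t < n + n].

Lemma phi_var s u : phi s (var u) = weight s u *: 'X_[expo u].
Proof. by rewrite /phi /= comp_mpolyXU -tnth_nth tnth_mktuple idxK. Qed.

Lemma phiX s m : phi s 'X_[m] = chi s m *: 'X_[invariant m].
Proof.
rewrite /phi /= comp_mpolyX (reindex idx) /=; last first.
  by exists unidx => t _; rewrite ?idxK ?unidxK.
rewrite /chi /invariant (big_morph _ (@mpolyXD _ k) (@mpolyX0 _ k)) -scaler_prod.
by apply: eq_bigr => u _; rewrite tnth_mktuple idxK exprZn mpolyXn.
Qed.

Lemma mcoeff_phi s p e :
  (phi s p)@_e = \sum_(m <- msupp p) p@_m * (chi s m * (invariant m == e)%:R).
Proof.
rewrite {1}[p]mpolyE rmorph_sum raddf_sum /=; apply: eq_bigr => m _.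
by rewrite comp_mpolyZ mcoeffZ -[_ \mPo _]/(phi s _) phiX mcoeffZ mcoeffX.
Qed.

Lemma phi_kills s p : I p -> phi s p = 0.
Proof.
apply: rmorph_generated_ideal => {}p [i [j [ij ->]]].
rewrite -[xvar k i]/(var (i, false)) -[xvar k j]/(var (j, false)).
rewrite -[yvar k i]/(var (i, true)) -[yvar k j]/(var (j, true)).
rewrite rmorphB !rmorphM /= !phi_var -!scalerAl -!scalerAr !scalerA -!mpolyXD.
rewrite /weight /= !mulr1.
have [iW|] := boolP (i \in W); last by rewrite !mul0r !scale0r subrr.
have [jW|] := boolP (j \in W); last by rewrite !(mulr0, mul0r) !scale0r subrr.
have ij_root : fingraph.root support_edge i = fingraph.root support_edge j.
  apply/(fingraph.rootP (sym_connect_sym support_edge_sym))/connect1.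
  by rewrite /support_edge ij iW.
have e b : cover_edge (i, b) (j, ~~ b) by rewrite /cover_edge /= ij iW jW /=.
have rootE b : fingraph.root cover_edge (i, b) = fingraph.root cover_edge (j, ~~ b).
  exact/(fingraph.rootP (sym_connect_sym cover_edge_sym))/connect1/e.
rewrite !mul1r ij_root -expr2 sqrr_sign /expo /= !rootE /=.
apply/eqP; rewrite subr_eq0; apply/eqP; congr (_ *: 'X_[_]).
by apply/mnmP=> t; rewrite !mnmDE; lia.
Qed.

(** This makes [chi], as a function of s, a character of the group of sign vectors
    when m is supported on W, and the zero function otherwise. *)
Lemma chi_addb (s s' : {ffun V -> bool}) m : chi [ffun i => s i (+) s' i] m = chi s m * chi s' m.
Proof.
rewrite /chi -big_split /=; apply: eq_bigr => u _; rewrite -exprMn; congr (_ ^+ _).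
rewrite /weight ffunE andb_addr signr_addb.
by case: (u.1 \in W); rewrite ?mul1r ?mul0r.
Qed.

Definition supp (m : 'X_{1..n + n}) : {set V} :=
  [set i | (0 < m (idx (i, false)) + m (idx (i, true)))%N].

Lemma mem_supp (m : 'X_{1..n + n}) u : (0 < m (idx u))%N -> u.1 \in supp m.
Proof. by case: u => i [] mu; rewrite inE addn_gt0 mu ?orbT. Qed.

Lemma suppP (m : 'X_{1..n + n}) i : i \in supp m -> exists b, (0 < m (idx (i, b)))%N.
Proof. by rewrite inE addn_gt0 => /orP[]; [exists false | exists true]. Qed.

Lemma chi_sign s m : supp m = W -> chi s m ^+ 2 = 1.
Proof.
move=> mW; rewrite /chi -prodrXl big1 // => u _.
rewrite -exprM mulnC exprM; case: (posnP (m (idx u))) => [->|/mem_supp]; first by rewrite expr0.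
by rewrite mW /weight => ->; rewrite mul1r sqrr_sign expr1n.
Qed.

Lemma invariant_vertex m i :
  invariant m (enum_rank (inl i : V + state)) = (m (idx (i, false)) + m (idx (i, true)))%N.
Proof.
rewrite /invariant mnm_sumE.
transitivity (\sum_j \sum_b (j == i) * m (idx (j, b)))%N.
  rewrite pair_bigA; apply: eq_bigr => -[j b] _.
  by rewrite mulmnE mnmDE !mnm1E !(can_eq enum_rankK) addn0.
rewrite (bigD1 i) //= [X in (_ + X)%N]big1 ?addn0; last first.
  by move=> j /negPf ji; rewrite big1 // => b _; rewrite ji.
by rewrite big_bool eqxx !mul1n addnC.
Qed.

Lemma invariant_component m u :
  invariant m (enum_rank (inr (fingraph.root cover_edge u) : V + state)) =
  (\sum_(v | connect cover_edge u v) m (idx v))%N.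
Proof.
rewrite /invariant mnm_sumE [RHS]big_mkcond; apply: eq_bigr => v _.
rewrite mulmnE mnmDE !mnm1E !(can_eq enum_rankK) add0n.
have -> : (inr (fingraph.root cover_edge v) == inr (fingraph.root cover_edge u) :> V + state)
    = connect cover_edge u v.
  by rewrite -(root_connect (sym_connect_sym cover_edge_sym)) [RHS]eq_sym.
by case: connect; rewrite ?mul1n.
Qed.

(** * Monomials with the same images are congruent *)

(** For m and m' of the same multidegree this vanishes only if m = m'. *)
Definition excess (m m' : 'X_{1..n + n}) : nat :=
  (\sum_u (m (idx u) - m' (idx u)))%N.

(** Too many factors at u means too few at [flip u], as the degree at each vertex
    is the same in m and m'; likewise for v.  So all four factors of the
    exchange move towards m'.  If v = flip u, the exchange moves two factors
    at once, whence the last hypothesis. *)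
Lemma exchange_closer (m m' : 'X_{1..n + n}) u v :
    supp m = W ->
    (forall i, m (idx (i, false)) + m (idx (i, true)) =
               m' (idx (i, false)) + m' (idx (i, true)))%N ->
    connect cover_edge u v ->
    (m' (idx u) < m (idx u))%N -> (m (idx v) < m' (idx v))%N ->
    (v = flip u -> m' (idx u) + 2 <= m (idx u))%N ->
  exists2 m1, 'X_[m] ~~~ 'X_[m1] & (excess m1 m' < excess m m')%N.
Proof.
move=> mW deg_eq uv lt_u lt_v gap.
have deg w : (m (idx w) + m (idx (flip w)) = m' (idx w) + m' (idx (flip w)))%N.
  by case: w => i [] /=; have := deg_eq i; rewrite /flip /=; lia.
have vu : v != u by apply: contraTneq lt_v => ->; lia.
pose a := (U_(idx u) + U_(idx (flip v)) : 'X_{1..n + n})%MM.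
pose b := (U_(idx (flip u)) + U_(idx v) : 'X_{1..n + n})%MM.
have aE w : a (idx w) = ((u == w) + (flip v == w))%N by rewrite mnmDE !mnm1E !eq_idx.
have bE w : b (idx w) = ((flip u == w) + (v == w))%N by rewrite mnmDE !mnm1E !eq_idx.
have am w : (a (idx w) <= m (idx w))%N.
  rewrite aE; case: (eqVneq (flip v) w) => [<-|_].
    case: (eqVneq u (flip v)) => [uv'|_]; last by have := deg v; lia.
    by have := gap (esym (etrans (congr1 flip uv') (flipK v))); rewrite uv'; lia.
  by case: (eqVneq u w) => [<-|_]; lia.
have mE : m = (a + (m - a))%MM.
  rewrite addmC submK //; apply/mnm_lepP => t.
  by rewrite -[t]unidxK am.
exists (b + (m - a))%MM.
  rewrite {1}mE !mpolyXD; apply: connect_exchange => // w wW wu wv.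
  have [c mc] := suppP (m := m) (i := w) ltac:(by rewrite mW); exists c.
  rewrite mnmBE aE; move: wu wv mc; rewrite [w == _]eq_sym [w == v.1]eq_sym => wu wv.
  have -> : (u == (w, c)) = false by apply: contraNF wu => /eqP->.
  have -> : (flip v == (w, c)) = false by apply: contraNF wv => /eqP[->].
  by rewrite subn0.
rewrite /excess (bigD1 u) //= [X in (_ < X)%N](bigD1 u) //=.
have termwise w : ((b + (m - a))%MM (idx w) - m' (idx w) <= m (idx w) - m' (idx w))%N.
  rewrite mnmDE mnmBE bE; case: (eqVneq v w) => [<-|_].
    case: (eqVneq (flip u) v) => [fuv|_]; last by lia.
    by have := gap (esym fuv); have := deg u; rewrite fuv; lia.
  case: (eqVneq (flip u) w) => [<-|_]; last by lia.
  by have := deg u; lia.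
rewrite -addSn leq_add //; last by apply: leq_sum => w _; apply: termwise.
have := lt_u; rewrite mnmDE mnmBE bE flip_neq (negPf vu) addn0 aE eqxx.
by case: (flip v == u) => /=; lia.
Qed.

Lemma connect_lift i l b :
  connect support_edge i l -> exists c, connect cover_edge (i, b) (l, c).
Proof.
case/connectP=> p; elim: p i b => [|j p IHp] i b /=.
  by move=> _ ->; exists b; apply: connect0.
case/andP=> /and3P[ij iW jW] jp /(IHp _ (~~ b) jp)[c jl]; exists c.
by apply: connect_trans jl; apply: connect1; rewrite /cover_edge /= ij iW jW /=.
Qed.

(** Over a non-bipartite component of G[W] the double cover is connected. *)
Lemma connect_both_lifts u l c :
    connect cover_edge u (flip u) -> connect support_edge u.1 l ->
  connect cover_edge u (l, c).
Proof.
move=> uu; rewrite (sym_connect_sym support_edge_sym) => /(connect_lift c)[d].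
rewrite (sym_connect_sym cover_edge_sym).
have [->|->] // : (u.1, d) = u \/ (u.1, d) = flip u by apply: same_vertex.
exact: connect_trans.
Qed.

(** If no exchange leads away from the vertex of u, that is, if m' exceeds m at
    no other vertex of the component, then m and m' agree there, and a gap of 1
    at u would give opposite parities to their y-degrees over the component.
    The sign vector negating that component alone would then separate them. *)
Lemma parity_gap (m m' : 'X_{1..n + n}) u :
    supp m = W ->
    (forall i, m (idx (i, false)) + m (idx (i, true)) =
               m' (idx (i, false)) + m' (idx (i, true)))%N ->
    (forall s, chi s m = chi s m') ->
    connect cover_edge u (flip u) ->
    (forall v, connect cover_edge u v -> v.1 != u.1 -> (m' (idx v) <= m (idx v))%N) ->
    (m' (idx u) < m (idx u))%N ->
  (m' (idx u) + 2 <= m (idx u))%N.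
Proof.
move=> mW deg_eq chi_eq uu above lt_u; rewrite leqNgt; apply/negP => gap.
pose i := u.1; pose s := [ffun j => j == fingraph.root support_edge i].
have iW : i \in W by rewrite -mW; apply: mem_supp (leq_trans _ lt_u).
have on_component j : connect support_edge u.1 j -> j != u.1 ->
    m (idx (j, true)) = m' (idx (j, true)).
  move=> uj ju; have le_j c : (m' (idx (j, c)) <= m (idx (j, c)))%N.
    by apply: above => //; apply: connect_both_lifts.
  by have := deg_eq j; have := le_j true; have := le_j false; lia.
have same v : v != (i, true) -> weight s v ^+ m (idx v) = weight s v ^+ m' (idx v).
  case: v => j [] vi; rewrite /weight /=; last first.
    have [jW|jW] := boolP (j \in W); first by rewrite mul1r !expr1n.
    have := deg_eq j; move: jW; rewrite -mW inE -leqNgt leqn0 addn_eq0.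
    by case/andP=> /eqP-> /eqP-> /esym/eqP; rewrite addn_eq0 => /andP[/eqP->].
  have [jW|jW] := boolP (j \in W); last first.
    have := deg_eq j; move: jW; rewrite -mW inE -leqNgt leqn0 addn_eq0.
    by case/andP=> /eqP-> /eqP-> /esym/eqP; rewrite addn_eq0 => /andP[_ /eqP->].
  rewrite ffunE (root_connect (sym_connect_sym support_edge_sym)).
  have [ji|_] := boolP (connect _ _ _); last by rewrite mul1r !expr1n.
  have ij : connect support_edge u.1 j by rewrite (sym_connect_sym support_edge_sym).
  have ji_neq : j != u.1 by apply: contraNneq vi => ->.
  by rewrite on_component.
have opp : chi s m = - chi s m'.
  rewrite /chi (bigD1 (i, true)) //= [in RHS](bigD1 (i, true)) //= -mulNr.
  congr (_ * _); last exact: eq_bigr.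
  rewrite /weight /= iW mul1r ffunE eqxx expr1.
  have [->|->] : m (idx (i, true)) = (m' (idx (i, true))).+1 \/
      m' (idx (i, true)) = (m (idx (i, true))).+1.
  - have uE : u = (i, u.2) by exact: surjective_pairing.
    have := deg_eq i; move: gap lt_u; rewrite uE /=.
    by case: u.2 => gap lt_u degi; [left | right]; lia.
  - by rewrite exprS mulN1r.
  - by rewrite exprS mulN1r opprK.
have /eqP := chi_sign s mW; apply/negP; rewrite sqrf_eq1; apply/negP.
have : chi s m *+ 2 == 0 by rewrite mulr2n {1}opp chi_eq addNr.
rewrite -mulr_natr mulf_eq0 (negPf two_neq0) orbF => /eqP->.
by rewrite eq_sym oner_eq0 /= eq_sym oppr_eq0 oner_eq0.
Qed.

End Support.

Lemma invariant_deg W (m m' : 'X_{1..n + n}) : invariant W m = invariant W m' ->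
  (forall i, m (idx (i, false)) + m (idx (i, true)) =
             m' (idx (i, false)) + m' (idx (i, true)))%N.
Proof. by move=> mm' i; rewrite -!(invariant_vertex W) mm'. Qed.

(** The image of a monomial supported on W is plus or minus a monomial, hence
    not 0: this is where equal images force m' to be supported on W as well. *)
Lemma phi_eq_monomial W (m m' : 'X_{1..n + n}) : supp m = W ->
    (forall s, phi W s 'X_[m] = phi W s 'X_[m']) ->
  invariant W m = invariant W m' /\ (forall s, chi W s m = chi W s m').
Proof.
move=> mW eq_phi.
have coef s : chi W s m = chi W s m' * (invariant W m' == invariant W m)%:R.
  have := congr1 (mcoeff (invariant W m)) (eq_phi s).
  by rewrite !phiX !mcoeffZ !mcoeffX eqxx mulr1.
have inv_eq : invariant W m' = invariant W m.
  apply/eqP; have := chi_sign [ffun=> false] mW; rewrite coef.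
  by case: eqP => // _; rewrite mulr0 expr0n /= => /esym/eqP; rewrite oner_eq0.
by split=> // s; rewrite coef inv_eq eqxx mulr1.
Qed.

Lemma cong_of_phi_eq (m m' : 'X_{1..n + n}) :
  (forall s, phi (supp m) s 'X_[m] = phi (supp m) s 'X_[m']) -> 'X_[m] ~~~ 'X_[m'].
Proof.
move: {-2}(supp m) (erefl (supp m)) => W /esym mW.
have [e] := ubnP (excess m m'); elim: e m mW => // e IHe m mW lt_e eq_phi.
have [<-|mm'] := eqVneq m m'; first exact: (cong_refl idealI).
have [inv_eq chi_eq] := phi_eq_monomial mW eq_phi.
have deg_eq := invariant_deg inv_eq.
suff [m1 mm1 lt_m1] : exists2 m1, 'X_[m] ~~~ 'X_[m1] & (excess m1 m' < excess m m')%N.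
  have phi1 s : phi W s 'X_[m1] = phi W s 'X_[m].
    by apply/eqP; rewrite eq_sym -subr_eq0 -rmorphB; apply/eqP/phi_kills.
  apply: cong_trans mm1 _ => //; apply: IHe.
  - rewrite -mW; apply/setP => i; rewrite !inE.
    have [inv1 _] := phi_eq_monomial mW (fun s => esym (phi1 s)).
    by rewrite (invariant_deg inv1).
  - exact: leq_trans lt_m1 _.
  - by move=> s; rewrite phi1.
have [u lt_u] : exists u, (m' (idx u) < m (idx u))%N.
  have [t] : exists t, m t != m' t.
    apply/existsP; rewrite -negb_forall; apply: contra mm' => /forallP eq_t.
    by apply/eqP/mnmP => t; apply/eqP.
  rewrite -[t]unidxK neq_ltn; case/orP=> [lt_t|]; last by exists (unidx t).
  exists (flip (unidx t)); move: lt_t; case: (unidx t) => i b.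
  by have := deg_eq i; rewrite /flip; case: b => /=; lia.
have [/existsP[v /and3P[uv lt_v vu]]|/existsPn none] :=
    boolP [exists v, [&& connect (cover_edge W) u v,
                         (m (idx v) < m' (idx v))%N & v.1 != u.1]].
  by apply: (exchange_closer mW deg_eq uv lt_u lt_v) => vE; rewrite vE eqxx in vu.
have above v : connect (cover_edge W) u v -> v.1 != u.1 -> (m' (idx v) <= m (idx v))%N.
  by move=> uv vu; have := none v; rewrite uv vu andbT /= -leqNgt.
have [v uv lt_v] : exists2 v, connect (cover_edge W) u v & (m (idx v) < m' (idx v))%N.
  apply/exists_inP; apply: contraT => /exists_inPn no_v.
  have := invariant_component W m u; rewrite inv_eq invariant_component => /eqP.
  rewrite (bigD1 u) ?connect0 //= [X in _ == X](bigD1 u) ?connect0 //=.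
  rewrite ltn_eqF // -addSn leq_add // leq_sum // => v /andP[uv _].
  by rewrite leqNgt; apply: no_v.
have vE : v = flip u.
  have [vu|/(above v uv)] := eqVneq v.1 u.1; last by lia.
  by have [vu'|] := same_vertex vu; first by move: lt_v; rewrite vu'; lia.
apply: (exchange_closer mW deg_eq uv lt_u lt_v) => _.
by apply: (parity_gap mW deg_eq chi_eq _ above lt_u); rewrite -vE.
Qed.

(** * The joint kernel *)

(** Orthogonality: translating s by s0 multiplies the summand by -1. *)
Lemma sum_chi_eq0 W (s0 : {ffun V -> bool}) (m m' : 'X_{1..n + n}) :
    supp m = W -> supp m' = W -> chi W s0 m != chi W s0 m' ->
  \sum_s chi W s m * chi W s m' = 0.
Proof.
move=> mW m'W neq.
have psi0 : chi W s0 m * chi W s0 m' = -1.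
  have /eqP := chi_sign s0 mW; have /eqP := chi_sign s0 m'W; move: neq.
  rewrite !sqrf_eq1 => neq /orP[] /eqP e' /orP[] /eqP e; move: neq; rewrite e e' ?eqxx //.
    by rewrite mulr1.
  by rewrite mul1r.
pose shift (s : {ffun V -> bool}) := [ffun i => s i (+) s0 i].
have shiftK : involutive shift.
  by move=> s; apply/ffunP => i; rewrite !ffunE -addbA addbb addbF.
set S := \sum_s _; suff : S *+ 2 == 0.
  by rewrite -mulr_natr mulf_eq0 (negPf two_neq0) orbF => /eqP.
rewrite mulr2n {2}/S (reindex_inj (inv_inj shiftK)) /= -big_split big1 //= => s _.
by rewrite !chi_addb mulrACA psi0 mulrN1 subrr.
Qed.

Definition same_image W (m0 m : 'X_{1..n + n}) : bool :=
  [forall s, phi W s 'X_[m0] == phi W s 'X_[m]].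

Lemma sum_same_image W (m0 : 'X_{1..n + n}) (p : {mpoly k[n + n]}) :
    supp m0 = W -> (forall s, phi W s p = 0) ->
  \sum_(m <- msupp p | same_image W m0 m) p@_m = 0.
Proof.
move=> m0W ker_p.
pose F m s := p@_m * ((chi W s m * chi W s m0) * (invariant W m == invariant W m0)%:R).
have sum0 : \sum_(m <- msupp p) \sum_s F m s = 0.
  rewrite exchange_big big1 //= => s _.
  transitivity (chi W s m0 * (phi W s p)@_(invariant W m0)).
    rewrite mcoeff_phi mulr_sumr; apply: eq_bigr => m _; rewrite /F; ring.
  by rewrite ker_p mcoeff0 mulr0.
have sumF m : \sum_s F m s = (if same_image W m0 m then p@_m else 0) * #|{ffun V -> bool}|%:R.
  rewrite -mulr_sumr -mulr_suml; case: ifPn => [/forallP eq_phi|].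
    have [inv_eq chi_eq] := phi_eq_monomial m0W (fun s => eqP (eq_phi s)).
    rewrite -inv_eq eqxx mulr1; congr (_ * _); rewrite -sum1_card natr_sum.
    by apply: eq_bigr => s _; rewrite -chi_eq -expr2 (chi_sign _ m0W).
  case/forallPn=> s0; rewrite !phiX mul0r => neq.
  have [inv_eq|_] := eqVneq (invariant W m) (invariant W m0); last by rewrite !mulr0.
  rewrite inv_eq in neq; rewrite (@sum_chi_eq0 W s0) ?mul0r ?mulr0 //.
    by rewrite -m0W; apply/setP => i; rewrite !inE (invariant_deg inv_eq).
  by apply: contraNneq neq => ->.
move: sum0; under eq_bigr do rewrite sumF.
rewrite -mulr_suml -big_mkcond /= => /eqP; rewrite mulf_eq0 => /orP[/eqP //|].
by rewrite card_ffun card_bool natrX expf_eq0 (negPf two_neq0) andbF.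
Qed.

(** Induction on the number of terms of p. *)
Lemma joint_kernel (p : {mpoly k[n + n]}) : (forall W s, phi W s p = 0) -> I p.
Proof.
have [e] := ubnP (size (msupp p)); elim: e p => // e IHe p lt_e ker_p.
have [->|p_neq0] := eqVneq p 0; first by case: idealI.
have [m0 m0p] : exists m0, m0 \in msupp p.
  by case E: (msupp p) p_neq0 => [|m0 r]; [rewrite -msupp_eq0 E | exists m0; rewrite mem_head].
pose W := supp m0; pose same := same_image W m0.
pose q := \sum_(m <- msupp p | same m) p@_m *: ('X_[m] - 'X_[m0]).
have Iq : I q.
  apply: ideal_sum => // m _ /forallP eq_phi; rewrite -mul_mpolyC.
  case: idealI => _ _; apply; apply: (cong_sym idealI (p := 'X_[m0]) (q := 'X_[m])).
  by apply: cong_of_phi_eq => s; apply/eqP.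
have qE : q = \sum_(m <- msupp p | same m) p@_m *: 'X_[m].
  rewrite /q; under eq_bigr do rewrite scalerBr; rewrite sumrB -scaler_suml.
  by rewrite sum_same_image // scale0r subr0.
rewrite -[p](subrK q); case: (idealI) => _ ID _; apply: ID => //; apply: IHe; last first.
  by move=> W' s; rewrite rmorphB /= ker_p (phi_kills _ _ Iq) subrr.
have pqE : p - q = \sum_(m <- msupp p | ~~ same m) p@_m *: 'X_[m].
  by rewrite {1}[p]mpolyE (bigID same) /= qE addrAC subrr add0r.
apply: leq_trans (_ : size [seq m <- msupp p | ~~ same m] < e)%N => //.
  apply: uniq_leq_size (msupp_uniq _) _ => m; rewrite pqE => /msupp_sum_le.
  case/flattenP=> _ /mapP[m' m'p ->] /msuppZ_le.
  by rewrite msuppX inE => /eqP->.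
rewrite ltnS in lt_e; apply: leq_trans lt_e; rewrite size_filter -(count_predC same).
rewrite -[X in (X < _)%N]add0n ltn_add2r -has_count; apply/hasP; exists m0 => //.
by apply/forallP.
Qed.

End ParityIdeal.

Theorem theorem5p5 (k : fieldType) (V : finType) (adj : rel V)
    (adj_sym : ssrbool.symmetric adj) (adj_irr : irreflexive adj)
    (char_k : 2%N \notin [pchar k]) :
  radical_ideal (parity_binomial_edge_ideal k adj).
Proof.
have two_neq0 : 2%:R != 0 :> k by move: char_k; rewrite inE.
apply: (@radical_ideal_of_domain_maps _ _ (generated_ideal_is_ideal _)
  ({set V} * {ffun V -> bool})%type _ (fun Ws => phi k adj Ws.1 Ws.2)).
- by move=> Ws p; apply: phi_kills.
- by move=> p ker_p; apply: joint_kernel => // W s; apply: (ker_p (W, s)).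
Qed.
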